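(* Let $L:\mathbb{R}^n\to[0,\infty)$ be a convex function such that $L(0)=0$ and $L(x)>0$ for $x\ne 0$. Then $L$ satisfies the $\Delta_2$-condition if and only if $$\sup_{|x|\ge 1}\frac{L'(x,x)}{L(x)}=\sup_{|x|\ge 1}\ \sup_{y\in\partial L(x)}\frac{\langle x,y\rangle}{L(x)}<\infty$$ (the two suprema being equal). In this case, both suprema are at most $p=R_L'(1+)$. If $L$ is differentiable, this condition simplifies to $$\sup_{|x|\ge 1}\frac{\langle\nabla L(x),x\rangle}{L(x)}<\infty .$$
   Context: $L$ is said to satisfy the $\Delta_2$-condition if there are positive constants $C$ and $x_0$ such that $L(2x)\le C L(x)$ for all $x\in\mathbb{R}^n$ with $|x|>x_0$. The directional derivative of $L$ at $x$ in the direction $\theta$ is $L'(x,\theta)=\lim_{\varepsilon\downarrow 0}\frac{L(x+\varepsilon\theta)-L(x)}{\varepsilon}$, for $x,\theta\in\mathbb{R}^n$. The subdifferential is $\partial L(x)=\{y\in\mathbb{R}^n: L(z)\ge L(x)+\langle y,z-x\rangle \text{ for all } z\in\mathbb{R}^n\}$. The function $R_L$ is defined by $R_L(r)=\sup_{|x|\ge 1}\frac{L(rx)}{L(x)}$, $r\ge 0$; under the $\Delta_2$-condition it is finite and convex on $[0,\infty)$, and $R_L'(1+)$ denotes its right derivative at $1$. *)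

(* Defs.v *)
From mathcomp Require Import all_boot all_order all_algebra.
From mathcomp Require Import all_classical all_reals all_analysis.
Set Implicit Arguments.
Unset Strict Implicit.
Unset Printing Implicit Defensive.
Import Order.TTheory GRing.Theory Num.Theory numFieldNormedType.Exports.
Local Open Scope classical_set_scope.
Local Open Scope ring_scope.

Definition dot (R : realType) (n : nat) (u v : 'rV[R]_n) : R :=
  \sum_(i < n) u 0 i * v 0 i.

(* The library norm `|x| on 'rV[R]_n is the sup norm, hence this definition of
   the Euclidean norm. *)
Definition enorm (R : realType) (n : nat) (x : 'rV[R]_n) : R :=
  Num.sqrt (dot x x).

Definition Delta2 (R : realType) (n : nat) (L : 'rV[R]_n -> R) : Prop :=
  exists C x0 : R, [/\ 0 < C, 0 < x0 &
    forall x : 'rV[R]_n, x0 < enorm x -> L (2 *: x) <= C * L x].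

(* For convex L the limit always exists. *)
Definition dirderiv (R : realType) (n : nat) (L : 'rV[R]_n -> R)
    (x theta : 'rV[R]_n) : R :=
  lim ((L (x + eps *: theta) - L x) / eps @[eps --> 0^'+]).

Definition subdifferential (R : realType) (n : nat) (L : 'rV[R]_n -> R)
    (x : 'rV[R]_n) : set 'rV[R]_n :=
  [set y | forall z, L x + dot y (z - x) <= L z].

Definition gradient (R : realType) (n : nat) (L : 'rV[R]_n -> R)
    (x : 'rV[R]_n) : 'rV[R]_n :=
  \row_(i < n) 'D_(delta_mx 0 i) L x.

Definition dilation_ratio (R : realType) (n : nat) (L : 'rV[R]_n -> R) (r : R) : \bar R :=
  ereal_sup [set (L (r *: x) / L x)%:E | x in [set x | 1 <= enorm x]].

(* The real-valued version of the function R_L; [fine] sends infinite values to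
   0, so this is R_L only where dilation_ratio L is finite. *)
Definition RL (R : realType) (n : nat) (L : 'rV[R]_n -> R) (r : R) : R :=
  fine (dilation_ratio L r).

Definition right_quotient (R : realType) (f : R -> R) (a h : R) : R :=
  (f (a + h) - f a) / h.

Definition right_derivable (R : realType) (f : R -> R) (a : R) : Prop :=
  cvg (right_quotient f a h @[h --> 0^'+]).

Definition right_derivative (R : realType) (f : R -> R) (a : R) : R :=
  lim (right_quotient f a h @[h --> 0^'+]).

Definition sup_dirderiv (R : realType) (n : nat) (L : 'rV[R]_n -> R) : \bar R :=
  ereal_sup [set (dirderiv L x x / L x)%:E | x in [set x | 1 <= enorm x]].

Definition sup_subdifferential (R : realType) (n : nat)
    (L : 'rV[R]_n -> R) : \bar R :=
  ereal_sup [set ereal_sup [set (dot x y / L x)%:E | y in subdifferential L x]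
            | x in [set x | 1 <= enorm x]].

Definition sup_gradient (R : realType) (n : nat) (L : 'rV[R]_n -> R) : \bar R :=
  ereal_sup [set (dot (gradient L x) x / L x)%:E | x in [set x | 1 <= enorm x]].

(* Main.v *)
(* Along a ray the difference quotients of L increase, so L'(x,x) is their
   infimum and t L'(x,x) <= L(x + t x) - L(x) for all real t. Replacing
   z |-> L(x + z) - L(x) successively by convex minorants that are affine along
   x (with slope L'(x,x)) and along each basis vector ends in a linear minorant,
   i.e. a subgradient y with <x,y> = L'(x,x): this gives the equality of suprema.
   Under Delta_2, continuity and compactness give L(2x) <= C L(x) on |x| >= 1,
   hence R_L is finite and convex, and L'(x,x)/L(x) is below every quotient
   (R_L(1+h) - R_L(1))/h. Conversely L'(x,x) <= p L(x) forces L(mu x) <= 2 L(x)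
   on |x| >= 1 for some mu > 1 depending only on p; iterating gives Delta_2. *)
Require Import Defs.
From mathcomp Require Import all_boot all_order all_algebra.
From mathcomp Require Import all_classical all_reals all_analysis.
From mathcomp Require Import ring lra.
Set Implicit Arguments.
Unset Strict Implicit.
Unset Printing Implicit Defensive.
Import Order.TTheory GRing.Theory Num.Theory numFieldNormedType.Exports.
Local Open Scope classical_set_scope.
Local Open Scope ring_scope.

(** * Convexity and monotone difference quotients *)

(** Plain real weights make the inequality directly usable by linear arithmetic. *)
Definition jensen (R : realType) (V : lmodType R) (f : V -> R) : Prop :=
  forall (x y : V) (t : R), 0 <= t -> t <= 1 ->
    f (t *: x + (1 - t) *: y) <= t * f x + (1 - t) * f y.

Lemma convex_function_jensen (R : realType) (V : lmodType R) (f : V -> R) :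
  convex_function [set: convex_lmodType V] f -> jensen f.
Proof.
move=> cf x y t t0 t1.
by have := cf (Itv01 t0 t1) x y (in_setT _) (in_setT _).
Qed.

Lemma jensen_shift (R : realType) (V : lmodType R) (f : V -> R) (x : V) :
  jensen f -> jensen (fun z => f (x + z) - f x).
Proof.
move=> cf y z t t0 t1.
have := cf (x + y) (x + z) t t0 t1.
rewrite !scalerDr addrACA -scalerDl (_ : t + (1 - t) = 1) ?scale1r; last by ring.
lra.
Qed.

(** Convexity against the value [b] at 0 makes the quotients nondecreasing in [h], and [b <= f h]
    keeps them nonnegative, so the limit is their infimum. The abstract [f] and [b] serve both [L]
    along a ray and R_L at 1. *)
Lemma right_quotient_limit (R : realType) (f : R -> R) (b : R) :
  (forall h t, 0 < h -> 0 <= t -> t <= 1 -> f (t * h) <= t * f h + (1 - t) * b) ->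
  (forall h, 0 < h -> b <= f h) ->
  exists l, [/\ (f h - b) / h @[h --> 0^'+] --> l,
    forall h, 0 < h -> l <= (f h - b) / h &
    forall m, (forall h, 0 < h -> m <= (f h - b) / h) -> m <= l].
Proof.
move=> cf bf.
pose S := [set (f h - b) / h | h in [set` Interval (BRight (0 : R)) (+oo%O)]].
have lbS : has_lbound S.
  exists 0 => y [h /=]; rewrite in_itv /= andbT => h0 <-.
  by rewrite divr_ge0 ?subr_ge0 ?bf// ltW.
have S0 : S !=set0 by exists ((f 1 - b) / 1); exists 1; rewrite //= in_itv /= ltr01.
exists (inf S); split.
- apply: nondecreasing_at_right_cvgr => //.
  move=> h k; rewrite !in_itv /= !andbT => h0 k0 hk.
  have h0' : h != 0 by rewrite gt_eqF.
  have k0' : k != 0 by rewrite gt_eqF.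
  have hk0 : 0 <= h / k by rewrite divr_ge0// ltW.
  have hk1 : h / k <= 1 by rewrite ler_pdivrMr// mul1r.
  have := cf k (h / k) k0 hk0 hk1; rewrite divfK// => H.
  rewrite ler_pdivrMr//.
  have -> : (f k - b) / k * h = (h / k) * f k - (h / k) * b by field.
  lra.
- move=> h h0; by apply: ge_inf => //; exists h => //=; rewrite in_itv /= h0.
- move=> m mh; apply: lb_le_inf => // y [h /=].
  by rewrite in_itv /= andbT => h0 <-; exact: mh.
Qed.

(** * Slopes, linear minorants and subgradients *)

(** 0 is the convex combination of [t *: v] and [- s *: v] with weights proportional to [s] and
    [t]. *)
Lemma slope_le_slope (R : realType) (V : lmodType R) (f : V -> R) (v : V) (s t : R) :
  jensen f -> f 0 = 0 -> 0 < s -> 0 < t -> - f (- s *: v) / s <= f (t *: v) / t.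
Proof.
move=> cf f0 s0 t0.
have st0 : 0 < s + t by rewrite addr_gt0.
have w0 : 0 <= s / (s + t) by rewrite divr_ge0// ltW.
have w1 : s / (s + t) <= 1 by rewrite ler_pdivrMr// mul1r lerDl ltW.
have := cf (t *: v) (- s *: v) (s / (s + t)) w0 w1.
rewrite !scalerA -scalerDl.
have -> : s / (s + t) * t + (1 - s / (s + t)) * - s = 0 by field; lra.
rewrite scale0r f0 => H.
rewrite ler_pdivrMr// mulrAC ler_pdivlMr//.
have : 0 <= (s / (s + t) * f (t *: v) + (1 - s / (s + t)) * f (- s *: v)) * (s + t).
  by rewrite mulr_ge0// ltW.
have -> : (s / (s + t) * f (t *: v) + (1 - s / (s + t)) * f (- s *: v)) * (s + t)
  = s * f (t *: v) + t * f (- s *: v) by field; lra.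
lra.
Qed.

(** The infimum of the right slopes works: left slopes lie below it, which covers negative [t]. *)
Lemma slope_exists (R : realType) (V : lmodType R) (f : V -> R) (v : V) :
  jensen f -> f 0 = 0 -> exists c : R, forall t, t * c <= f (t *: v).
Proof.
move=> cf f0.
pose S := [set f (t *: v) / t | t in [set t : R | 0 < t]].
have lbS : has_lbound S.
  by exists (- f (- 1 *: v) / 1) => _ [t /= t0 <-]; apply: slope_le_slope.
have S0 : S !=set0 by exists (f (1 *: v) / 1), 1 => /=.
exists (inf S) => t.
have [t0|t0|->] := ltgtP t 0; last by rewrite mul0r scale0r f0.
- have : - f (- (- t) *: v) / (- t) <= inf S.
    by apply: lb_le_inf => // _ [u /= u0 <-]; apply: slope_le_slope => //; lra.
  rewrite opprK ler_pdivrMr; last lra.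
  lra.
- have : inf S <= f (t *: v) / t by apply: ge_inf => //; exists t.
  by rewrite ler_pdivlMr// mulrC.
Qed.

(* The witness is g z = inf_t (f (z + t v) - t c). *)
Lemma affine_minorant (R : realType) (V : lmodType R) (f : V -> R) (v : V) (c : R) :
  jensen f -> f 0 = 0 -> (forall t, t * c <= f (t *: v)) ->
  exists g : V -> R, [/\ jensen g, g 0 = 0, (forall z, g z <= f z),
    (forall z t, g (z + t *: v) = g z + t * c) &
    forall w d, (forall z t, f (z + t *: w) = f z + t * d) ->
      forall z t, g (z + t *: w) = g z + t * d].
Proof.
move=> cf f0 fc.
pose S z := [set f (z + t *: v) - t * c | t in [set: R]].
(* The midpoint of [z + t *: v] and [- z] lies on the line of [v], where [f] is bounded below by
   slope [c]; hence the infimum is finite. *)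
have lbS z : lbound (S z) (- f (- z)).
  move=> _ [t _ <-].
  have := cf (z + t *: v) (- z) 2^-1.
  have -> : (1 - 2^-1 : R) = 2^-1 by lra.
  rewrite -scalerDr addrAC subrr add0r scalerA => H.
  have {H} : f ((2^-1 * t) *: v) <= 2^-1 * f (z + t *: v) + 2^-1 * f (- z) by apply: H; lra.
  have := fc (2^-1 * t); lra.
have hS z : has_lbound (S z) by exists (- f (- z)).
have S0 z : S z !=set0 by exists (f (z + 0 *: v) - 0 * c), 0.
pose g z := inf (S z).
have gle z t : g z <= f (z + t *: v) - t * c by apply: ge_inf => //; exists t.
have leg z m : (forall t, m <= f (z + t *: v) - t * c) -> m <= g z.
  by move=> H; apply: lb_le_inf => // _ [t _ <-].
have shift w d : (forall z t, g z + t * d <= g (z + t *: w)) ->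
    forall z t, g (z + t *: w) = g z + t * d.
  move=> H z t; apply/eqP; rewrite eq_le H andbT.
  have := H (z + t *: w) (- t); rewrite scaleNr addrK; lra.
exists g; split.
- move=> x y t t0 t1.
  apply/ler_addgt0Pr => e e0.
  (* Near-minimizers [r] and [s] combine into the parameter [t * r + (1 - t) * s]. *)
  have [_ [r _ <-] hr] := inf_adherent e0 (conj (S0 x) (hS x)).
  have [_ [s _ <-] hs] := inf_adherent e0 (conj (S0 y) (hS y)).
  have := gle (t *: x + (1 - t) *: y) (t * r + (1 - t) * s).
  have := cf (x + r *: v) (y + s *: v) t t0 t1.
  rewrite !scalerDr addrACA !scalerA -scalerDl -/(g x) -/(g y) in hr hs *.
  move=> H1 H2.
  have A1 : t * (f (x + r *: v) - r * c) <= t * (g x + e) by rewrite ler_wpM2l// ltW.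
  have A2 : (1 - t) * (f (y + s *: v) - s * c) <= (1 - t) * (g y + e).
    by rewrite ler_wpM2l ?subr_ge0// ltW.
  lra.
- apply/eqP; rewrite eq_le; apply/andP; split.
    by have := gle 0 0; rewrite scale0r addr0 f0 mul0r subr0.
  by apply: leg => t; rewrite add0r subr_ge0.
- by move=> z; have := gle z 0; rewrite scale0r addr0 mul0r subr0.
- apply: shift => z t; apply: leg => s; rewrite -addrA -scalerDl.
  have := gle z (t + s); lra.
- move=> w d fw; apply: shift => z t; apply: leg => s; rewrite addrAC fw.
  have := gle z s; lra.
Qed.

(** The last clause of [affine_minorant] preserves the directions already made affine, so the
    construction iterates. *)
Lemma affine_minorant_seq (R : realType) (V : lmodType R) (f : V -> R) (s : seq V) :
  jensen f -> f 0 = 0 ->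
  exists g : V -> R, [/\ jensen g, g 0 = 0, (forall z, g z <= f z) &
    forall v, v \in s -> exists c, forall z t, g (z + t *: v) = g z + t * c].
Proof.
move=> cf f0; elim: s => [|v s [g [cg g0 gf gs]]]; first by exists f; split.
have [c hc] := slope_exists v cg g0.
have [k [ck k0 kg kv kw]] := affine_minorant cg g0 hc.
exists k; split => // [z|w]; first exact: le_trans (kg z) (gf z).
rewrite inE => /predU1P[->|/gs [d hd]]; first by exists c.
by exists d; apply: kw.
Qed.

(** A minorant affine along every basis vector and null at 0 is linear; its slopes are the
    coordinates of [y]. *)
Lemma linear_minorant (R : realType) (n : nat) (f : 'rV[R]_n -> R) :
  jensen f -> f 0 = 0 -> exists y : 'rV[R]_n, forall z, dot y z <= f z.
Proof.
move=> cf f0.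
have [g [_ g0 gf gs]] := affine_minorant_seq [seq 'e_i | i <- enum 'I_n] cf f0.
have /choice [c hc] : forall i : 'I_n, exists c, forall z t, g (z + t *: 'e_i) = g z + t * c.
  by move=> i; apply: gs; rewrite map_f// mem_enum.
exists (\row_i c i) => z; apply: le_trans (gf z).
rewrite {2}(row_sum_delta z) /dot.
suff -> : forall r : seq 'I_n,
    g (\sum_(i <- r) z 0 i *: 'e_i) = \sum_(i <- r) (\row_i c i) 0 i * z 0 i by [].
elim=> [|i r IH]; first by rewrite !big_nil.
by rewrite !big_cons addrC hc IH mxE addrC mulrC.
Qed.

(** The slope [c] along [v] is fixed first; any linear minorant of the resulting function must then
    have that slope. *)
Lemma subgradient_of_slope (R : realType) (n : nat) (L : 'rV[R]_n -> R)
    (x v : 'rV[R]_n) (c : R) :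
  jensen L -> (forall t, t * c <= L (x + t *: v) - L x) ->
  exists2 y, subdifferential L x y & dot v y = c.
Proof.
move=> cL Lc.
pose f z := L (x + z) - L x.
have cf : jensen f by exact: jensen_shift.
have f0 : f 0 = 0 by rewrite /f addr0 subrr.
have [g [cg g0 gf gv _]] := affine_minorant cf f0 Lc.
have [y hy] := linear_minorant cg g0.
exists y.
  move=> z /=; have := le_trans (hy (z - x)) (gf (z - x)).
  by rewrite /f (addrC x) subrK; lra.
have dotZ t : dot y (t *: v) = t * dot v y.
  by rewrite /dot mulr_sumr; apply: eq_bigr => i _; rewrite mxE; ring.
(* Both signs of [t] are allowed here, which forces equality of the slopes. *)
have H t : t * dot v y <= t * c.
  by rewrite -dotZ; apply: le_trans (hy _) _; rewrite -[_ *: v]add0r gv g0 add0r.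
have := H 1; have := H (-1); lra.
Qed.

(** * Continuity of convex functions *)

Lemma jensen_scale_le (R : realType) (V : lmodType R) (f : V -> R) (v : V) (t : R) :
  jensen f -> f 0 = 0 -> 0 <= t -> t <= 1 -> f (t *: v) <= t * f v.
Proof.
move=> cf f0 t0 t1; have := cf v 0 t t0 t1.
by rewrite scaler0 addr0 f0 mulr0 addr0.
Qed.

(* Halving splits off one coordinate direction at a time, so no Jensen
   inequality for n points is needed. *)
Lemma jensen_locally_bounded (R : realType) (n : nat) (f : 'rV[R]_n -> R) :
  jensen f -> f 0 = 0 ->
  exists K d : R, [/\ 0 <= K, 0 < d & forall s (z : 'rV[R]_n), 0 <= s -> s <= d ->
    (forall i, `|z 0 i| <= s) -> f z <= K * s].
Proof.
move=> cf f0.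
suff [K [d [K0 d0 H]]] : exists K d : R, [/\ 0 <= K, 0 < d &
    forall s (z : 'rV[R]_n), 0 <= s -> s <= d ->
    (forall i, `|z 0 i| <= s) -> f (\sum_(i <- enum 'I_n) z 0 i *: 'e_i) <= K * s].
  exists K, d; split=> // s z s0 sd zs.
  by rewrite [z]row_sum_delta -big_enum/=; apply: H.
elim: (enum 'I_n) => [|i r [K [d [K0 d0 IH]]]].
  by exists 0, 1; split => // s z _ _ _; rewrite big_nil f0 mul0r.
pose M := Num.max 0 (Num.max (f 'e_i) (f (- 'e_i))).
have M0 : 0 <= M by rewrite /M le_max lexx.
have Mp : f 'e_i <= M by rewrite /M !le_max lexx orbT.
have Mn : f (- 'e_i) <= M by rewrite /M !le_max lexx !orbT.
have hM t : `|t| <= 1 -> f (t *: 'e_i) <= `|t| * M.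
  move=> t1; have [t0|t0] := leP 0 t.
    rewrite (ger0_norm t0) in t1 *.
    by rewrite (le_trans (jensen_scale_le _ cf f0 t0 t1))// ler_wpM2l.
  have Nt0 : 0 <= - t by lra.
  rewrite (ltr0_norm t0) in t1 *.
  have -> : t *: 'e_i = (- t) *: (- 'e_i : 'rV[R]_n) by rewrite scalerN scaleNr opprK.
  by rewrite (le_trans (jensen_scale_le _ cf f0 Nt0 t1))// ler_wpM2l.
(* Doubled coordinates must stay within 1 for [hM] and within [d] for [IH]; in the bound the factors
   2 and 1/2 cancel. *)
exists (M + K), (Num.min 2^-1 (d / 2)); split.
- by rewrite addr_ge0.
- by rewrite lt_min; apply/andP; split; lra.
move=> s z s0; rewrite le_min => /andP[s1 sd] zs; rewrite big_cons.
have h2 : 0 <= (2^-1 : R) by lra.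
have h2' : 2^-1 <= (1 : R) by lra.
have := cf ((2 * z 0 i) *: 'e_i) (\sum_(j <- r) (2 *: z) 0 j *: 'e_j) 2^-1 h2 h2'.
have -> : (1 - 2^-1 : R) = 2^-1 by lra.
rewrite -scalerDr (eq_bigr (fun j => 2 *: (z 0 j *: 'e_j))); last first.
  by move=> j _; rewrite mxE scalerA.
rewrite -scaler_sumr -scalerA -scalerDr scalerA mulVf ?pnatr_eq0// scale1r.
move=> /le_trans; apply.
have A1 : f ((2 * z 0 i) *: 'e_i) <= (2 * s) * M.
  have n2 : `|2 * z 0 i| <= 2 * s by rewrite normrM ger0_norm// ler_wpM2l.
  by rewrite (le_trans (hM _ _))// ?ler_wpM2r//; lra.
have A2 : f (2 *: \sum_(j <- r) z 0 j *: 'e_j) <= K * (2 * s).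
  have := IH (2 * s) (2 *: z).
  rewrite (eq_bigr (fun j => 2 *: (z 0 j *: 'e_j))); last first.
    by move=> j _; rewrite mxE scalerA.
  rewrite -scaler_sumr; apply; [lra|lra|].
  by move=> j; rewrite mxE normrM ger0_norm// ler_wpM2l.
rewrite scalerA in A1 *.
lra.
Qed.

Lemma coord_le_norm (R : realType) (n : nat) (z : 'rV[R]_n) (i : 'I_n) :
  `|z 0 i| <= `|z|.
Proof.
by rewrite [leRHS]/Num.Def.normr /= mx_normrE; apply/bigmax_geP; right; exists (0, i).
Qed.

(** The local upper bound at [x] yields a lower one by reflection: [x] is the midpoint of [y] and
    [x - (y - x)]. *)
Lemma jensen_continuous (R : realType) (n : nat) (f : 'rV[R]_n -> R) :
  jensen f -> continuous f.
Proof.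
move=> cf x.
have [||K [d [K0 d0 H]]] := @jensen_locally_bounded R n (fun z => f (x + z) - f x).
- exact: jensen_shift.
- by rewrite addr0 subrr.
apply/(@cvgrPdist_le _ _ _ (nbhs x) (nbhs_filter x)) => e e0.
have K1 : 0 < K + 1 by lra.
near=> y.
have yd : `|y - x| <= Num.min d (e / (K + 1)).
  rewrite distrC; near: y; apply: (@cvgr_dist_le _ _ _ (nbhs x) _ id); first exact: cvg_id.
  by rewrite lt_min d0 divr_gt0.
move: yd; rewrite le_min ler_pdivlMr// => /andP[yd ye].
have s0 : 0 <= `|y - x| by [].
have Ke : K * `|y - x| <= e by move: ye s0; lra.
have H1 : f y - f x <= e.
  have := H `|y - x| (y - x) s0 yd (coord_le_norm _).
  by rewrite [x + _]addrC subrK => /le_trans; apply.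
have H2 : f (x - (y - x)) - f x <= e.
  have := H `|y - x| (- (y - x)) s0 yd.
  by move=> /(_ _)/le_trans; apply => // i; rewrite mxE normrN coord_le_norm.
have h2 : 0 <= (2^-1 : R) by lra.
have h2' : 2^-1 <= (1 : R) by lra.
have := cf y (x - (y - x)) 2^-1 h2 h2'.
have -> : (1 - 2^-1 : R) = 2^-1 by lra.
have midE : y + (x - (y - x)) = 2 *: x.
  by rewrite opprB addrCA [y + _]addrC subrK scaler_nat mulr2n.
rewrite -scalerDr midE scalerA mulVf ?pnatr_eq0// scale1r ler_norml.
lra.
Unshelve. all: by end_near. Qed.

(** * The Euclidean norm and its annuli *)

Lemma dotZZ (R : realType) (n : nat) (r : R) (x : 'rV[R]_n) :
  dot (r *: x) (r *: x) = r ^+ 2 * dot x x.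
Proof. by rewrite /dot mulr_sumr; apply: eq_bigr => i _; rewrite !mxE; ring. Qed.

Lemma dot_coord_le (R : realType) (n : nat) (x : 'rV[R]_n) (i : 'I_n) :
  x 0 i ^+ 2 <= dot x x.
Proof.
rewrite /dot (bigD1 i)//= -expr2 lerDl.
by apply: sumr_ge0 => j _; rewrite -expr2 sqr_ge0.
Qed.

Lemma enormZ (R : realType) (n : nat) (r : R) (x : 'rV[R]_n) :
  enorm (r *: x) = `|r| * enorm x.
Proof. by rewrite /enorm dotZZ sqrtrM ?sqr_ge0// sqrtr_sqr. Qed.

Lemma enorm_scale_ge1 (R : realType) (n : nat) (r : R) (x : 'rV[R]_n) :
  1 <= r -> 1 <= enorm x -> 1 <= enorm (r *: x).
Proof.
move=> r1 x1; rewrite enormZ ger0_norm; last exact: le_trans r1.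
by rewrite -[leLHS]mulr1 ler_pM.
Qed.

Lemma enorm_ge1_neq0 (R : realType) (n : nat) (x : 'rV[R]_n) :
  1 <= enorm x -> x != 0.
Proof.
apply: contraTneq => ->; rewrite -ltNge -(scale0r 0) enormZ normr0 mul0r.
exact: ltr01.
Qed.

(** Boundedness refers to the sup norm, which the Euclidean norm dominates coordinatewise;
    closedness comes from continuity of [enorm]. *)
Lemma annulus_compact (R : realType) (n : nat) (r : R) :
  compact [set x : 'rV[R]_n | 1 <= enorm x /\ enorm x <= r].
Proof.
have -> : [set x : 'rV[R]_n | 1 <= enorm x /\ enorm x <= r] =
    @enorm R n @^-1` `[1, r]%classic.
  by apply/seteqP; split=> x /=; rewrite in_itv/= => /andP.
apply: bounded_closed_compact.
  exists r; split; first exact: num_real.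
  move=> M rM x /=; rewrite in_itv/= => /andP[x1 xr].
  have r0 : 0 <= r by lra.
  rewrite [leLHS]/Num.Def.normr/= mx_normrE; apply/bigmax_leP; split=> [|[i j] _ /=]; first lra.
  rewrite [i]ord1 (le_trans _ (ltW rM))// (le_trans _ xr)// -sqrtr_sqr ler_wsqrtr//.
  exact: dot_coord_le.
apply: preimage_closed; last exact: itv_closed.
move=> x _; apply: (@continuous_comp _ _ _ (fun x => dot x x) Num.sqrt).
  move: x; apply: (@continuous_big _ _ +%R 0) => [|i _ y]; first exact: add_continuous.
  by apply: (@cvgM _ _ (nbhs y) (nbhs_filter y)); exact: coord_continuous.
exact: sqrt_continuous.
Qed.

(** * Growth along rays and doubling on |x| >= 1 *)

(** For [s > 0], [s *: x] is the fraction [s / t] of [t *: x], and nonnegativity absorbs the factor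
    [s / t <= 1]. *)
Lemma jensen_ray_le (R : realType) (V : lmodType R) (f : V -> R) (x : V) (s t : R) :
  jensen f -> f 0 = 0 -> (forall z, 0 <= f z) -> 0 <= s -> s <= t ->
  f (s *: x) <= f (t *: x).
Proof.
move=> cf f0 fge0 s0 st.
have [->|s0'] := eqVneq s 0; first by rewrite scale0r f0.
have t0 : 0 < t by rewrite (lt_le_trans _ st)// lt_neqAle eq_sym s0'.
have w0 : 0 <= s / t by rewrite divr_ge0// ltW.
have w1 : s / t <= 1 by rewrite ler_pdivrMr// mul1r.
have := jensen_scale_le (t *: x) cf f0 w0 w1.
rewrite scalerA divfK ?gt_eqF// => /le_trans; apply.
by rewrite -[leRHS]mul1r ler_wpM2r.
Qed.

(** The threshold [x0] is lowered to 1: on the compact annulus between them the continuous ratio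
    [L (2 *: x) / L x] has a maximum. *)
Lemma Delta2_doubling (R : realType) (n : nat) (L : 'rV[R]_n -> R) :
  jensen L -> (forall x, x != 0 -> 0 < L x) -> Delta2 L ->
  exists2 C, 0 < C & forall x, 1 <= enorm x -> L (2 *: x) <= C * L x.
Proof.
move=> cL Lgt0 [C [x0 [C0 x00 HC]]].
pose A := [set x : 'rV[R]_n | 1 <= enorm x /\ enorm x <= x0].
(* The extreme value theorem needs a nonempty annulus; if it is empty, every [x] with [1 <= enorm x]
   lies beyond [x0]. *)
have [[a Aa]|A0] := pselect (A !=set0); last first.
  exists C => // x x1; apply: HC; rewrite ltNge; apply/negP => xx0.
  by apply: A0; exists x.
have Lcont := jensen_continuous cL.
have ratio_cont : {within A, continuous (fun x => L (2 *: x) / L x)}.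
  apply: continuous_in_subspaceT => x; rewrite inE => -[x1 _].
  apply: (@cvgM _ _ (nbhs x) (nbhs_filter x)).
    apply: (@jensen_continuous R n (fun x => L (2 *: x))) => y z t t0 t1.
    by have := cL (2 *: y) (2 *: z) t t0 t1; rewrite scalerDr !scalerA !(mulrC 2).
  apply: (@cvgV _ _ (nbhs x) (nbhs_filter x)); last exact: Lcont.
  by rewrite gt_eqF// Lgt0// enorm_ge1_neq0.
have [c _ hc] := EVT_max_rV (ex_intro _ a Aa) (@annulus_compact R n x0) ratio_cont.
exists (Num.max C (L (2 *: c) / L c)); first by rewrite lt_max C0.
move=> x x1.
have Lx0 : 0 < L x by rewrite Lgt0// enorm_ge1_neq0.
have [xx0|xx0] := leP (enorm x) x0.
  rewrite -ler_pdivrMr//; apply: le_trans (_ : L (2 *: c) / L c <= _).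
    by apply: hc; rewrite inE.
  by rewrite le_max lexx orbT.
apply: (le_trans (HC x xx0)); apply: ler_wpM2r; first exact: ltW.
by rewrite le_max lexx.
Qed.

(** * Directional derivatives along rays *)

(** Growth along rays supplies the lower bound for [right_quotient_limit]; the two clauses identify
    L'(x,x) as the infimum of the quotients. *)
Lemma dirderiv_ray (R : realType) (n : nat) (L : 'rV[R]_n -> R) (x : 'rV[R]_n) :
  jensen L -> L 0 = 0 -> (forall z, 0 <= L z) ->
  (forall h, 0 < h -> dirderiv L x x <= (L (x + h *: x) - L x) / h) /\
  (forall m, (forall h, 0 < h -> m <= (L (x + h *: x) - L x) / h) ->
    m <= dirderiv L x x).
Proof.
move=> cL L0 L_ge0.
have [h t h0 t0 t1|h h0|l [lim_l l_le le_l]] :=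
    @right_quotient_limit R (fun h => L (x + h *: x)) (L x).
- have := cL (x + h *: x) x t t0 t1.
  by rewrite scalerDr addrAC -scalerDl (_ : t + (1 - t) = 1) ?scale1r ?scalerA//; ring.
- have := @jensen_ray_le R _ L x 1 (1 + h) cL L0 L_ge0.
  by rewrite scalerDl !scale1r; apply; lra.
suff -> : dirderiv L x x = l by [].
exact/cvg_lim.
Qed.

(** Left slopes lie below all right slopes, hence below their infimum; the resulting case of
    negative [t] serves to go backwards along a ray. *)
Lemma dirderiv_slope (R : realType) (n : nat) (L : 'rV[R]_n -> R) (x : 'rV[R]_n) (t : R) :
  jensen L -> L 0 = 0 -> (forall z, 0 <= L z) ->
  t * dirderiv L x x <= L (x + t *: x) - L x.
Proof.
move=> cL L0 L_ge0; have [D_le le_D] := dirderiv_ray x cL L0 L_ge0.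
have [t0|t0|->] := ltgtP t 0; last by rewrite mul0r scale0r addr0 subrr.
- have Nt0 : 0 < - t by lra.
  have : - (L (x + - - t *: x) - L x) / - t <= dirderiv L x x.
    apply: le_D => h h0.
    apply: (@slope_le_slope R _ (fun z => L (x + z) - L x)) => //.
      exact: jensen_shift.
    by rewrite addr0 subrr.
  rewrite opprK ler_pdivrMr//; lra.
- have := D_le t t0; rewrite ler_pdivlMr//; lra.
Qed.

(** * Iterated growth bounds *)

Lemma ereal_sup_lty (R : realType) (T : Type) (A : set T) (F : T -> R) :
  (ereal_sup [set (F x)%:E | x in A] < +oo)%E ->
  exists2 p, 0 <= p & forall x, A x -> F x <= p.
Proof.
set S := [set _ | _ in _] => supS.
exists (Num.max 0 (fine (ereal_sup S))); first by rewrite le_max lexx.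
move=> x Ax; rewrite le_max; apply/orP; right.
have : ((F x)%:E <= ereal_sup S)%E by apply: ereal_sup_ubound; exists x.
by case: (ereal_sup S) supS.
Qed.

(** Bernoulli's inequality with [N > 1 / h]. *)
Lemma one_plus_exp_ge2 (R : realType) (h : R) : 0 < h ->
  exists N, 2 <= (1 + h) ^+ N.
Proof.
move=> h0.
have bern N : 1 + N%:R * h <= (1 + h) ^+ N.
  elim: N => [|N IH]; first by rewrite mul0r addr0 expr0.
  rewrite exprS; have : (1 + h) * (1 + N%:R * h) <= (1 + h) * (1 + h) ^+ N.
    by rewrite ler_wpM2l//; lra.
  apply: le_trans; rewrite -natr1.
  have : 0 <= N%:R * h * h by rewrite !mulr_ge0// ltW.
  lra.
exists (Num.bound h^-1); apply: le_trans (bern _).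
have : h^-1 < (Num.bound h^-1)%:R by rewrite archi_boundP// invr_ge0 ltW.
rewrite -[X in X < _]div1r ltr_pdivrMr//; lra.
Qed.

Lemma growth_iter (R : realType) (n : nat) (L : 'rV[R]_n -> R) (mu C : R) :
  1 <= mu -> 0 <= C -> (forall x, 1 <= enorm x -> L (mu *: x) <= C * L x) ->
  forall k x, 1 <= enorm x -> L (mu ^+ k *: x) <= C ^+ k * L x.
Proof.
move=> mu1 C0 LC; elim=> [|k IH] x x1; first by rewrite !expr0 scale1r mul1r.
rewrite !exprS -scalerA; apply: le_trans (LC _ _) _.
  by apply: enorm_scale_ge1 => //; exact: exprn_ege1.
by rewrite -mulrA ler_wpM2l// IH.
Qed.

(** Choosing [k] with [r <= 2 ^+ k] reduces to [k] doublings; this is the finiteness of R_L(r). *)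
Lemma Delta2_growth (R : realType) (n : nat) (L : 'rV[R]_n -> R) (r : R) :
  jensen L -> L 0 = 0 -> (forall x, 0 <= L x) -> (forall x, x != 0 -> 0 < L x) ->
  Delta2 L -> 0 <= r ->
  exists M, forall x, 1 <= enorm x -> L (r *: x) / L x <= M.
Proof.
move=> cL L0 L_ge0 L_gt0 /(Delta2_doubling cL L_gt0)[C C0 LC] r0.
pose k := Num.bound r.
have rk : r <= 2 ^+ k.
  rewrite (le_trans (ltW (archi_boundP r0)))// -natrX ler_nat ltnW//.
  exact: ltn_expl.
exists (C ^+ k) => x x1; rewrite ler_pdivrMr ?L_gt0 ?enorm_ge1_neq0//.
apply: (le_trans (jensen_ray_le x cL L0 L_ge0 r0 rk)).
by apply: (growth_iter _ (ltW C0) LC) => //; lra.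
Qed.

(** With z = mu x, so x = (1 - h) z, the slope bound backwards from z gives L(x) >= L(z) - h L'(z,z)
    >= (1 - h p) L(z) >= L(z) / 2. *)
Lemma dirderiv_bound_Delta2 (R : realType) (n : nat) (L : 'rV[R]_n -> R) (p : R) :
  jensen L -> L 0 = 0 -> (forall x, 0 <= L x) -> 0 <= p ->
  (forall x, 1 <= enorm x -> dirderiv L x x <= p * L x) -> Delta2 L.
Proof.
move=> cL L0 L_ge0 p0 Dp.
(* This choice gives h p + h = 1/2, so both terms are at most 1/2, even for [p = 0]. *)
pose h := (2 * (p + 1))^-1.
have hE : h * (2 * (p + 1)) = 1 by rewrite mulVf//; lra.
have h0 : 0 < h by rewrite invr_gt0; lra.
have hp : h * p <= 2^-1 by lra.
have h1 : h <= 2^-1.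
  have : 0 <= h * p by rewrite mulr_ge0// ltW.
  lra.
pose mu := (1 - h)^-1.
have muE : (1 - h) * mu = 1 by rewrite mulfV//; lra.
have mu0 : 0 <= mu by rewrite invr_ge0; lra.
have mu_ge : 1 + h <= mu.
  have : 0 <= h ^+ 2 * mu by rewrite mulr_ge0// sqr_ge0.
  have : (1 + h) * ((1 - h) * mu) = mu - h ^+ 2 * mu by ring.
  rewrite muE; lra.
have step x : 1 <= enorm x -> L (mu *: x) <= 2 * L x.
  move=> x1; have z1 : 1 <= enorm (mu *: x) by apply: enorm_scale_ge1 => //; lra.
  have := dirderiv_slope (mu *: x) (- h) cL L0 L_ge0.
  have -> : mu *: x + - h *: (mu *: x) = x.
    by rewrite scalerA -scalerDl (_ : mu + - h * mu = 1) ?scale1r//; lra.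
  have : h * dirderiv L (mu *: x) (mu *: x) <= h * (p * L (mu *: x)).
    by rewrite ler_wpM2l ?Dp// ltW.
  have : (h * p) * L (mu *: x) <= 2^-1 * L (mu *: x) by rewrite ler_wpM2r.
  lra.
(* As [mu >= 1 + h], some power of [mu] reaches 2, and [N] steps cover a doubling. *)
have [N hN] := one_plus_exp_ge2 h0.
have muN : 2 <= mu ^+ N.
  by rewrite (le_trans hN)// lerXn2r// nnegrE; lra.
exists (2 ^+ N), 1; split => // x /ltW x1.
have two0 : 0 <= (2 : R) by [].
apply: (le_trans (jensen_ray_le x cL L0 L_ge0 two0 muN)).
by apply: (growth_iter _ two0 step) => //; lra.
Qed.

(** * Equality of the two suprema *)

Lemma sup_dirderivE (R : realType) (n : nat) (L : 'rV[R]_n -> R) :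
  jensen L -> L 0 = 0 -> (forall x, 0 <= L x) -> (forall x, x != 0 -> 0 < L x) ->
  sup_dirderiv L = sup_subdifferential L.
Proof.
move=> cL L0 L_ge0 L_gt0; apply/eqP; rewrite eq_le; apply/andP; split.
  apply: ge_ereal_sup => _ [x x1 <-].
  have [y yL xy] := subgradient_of_slope cL
    (fun t => dirderiv_slope x t cL L0 L_ge0).
  apply: le_trans (_ : ereal_sup [set (dot x y / L x)%:E | y in subdifferential L x] <= _)%E.
    by apply: ereal_sup_ubound; exists y => //; rewrite xy.
  by apply: ereal_sup_ubound; exists x.
apply: ge_ereal_sup => _ [x x1 <-]; apply: ge_ereal_sup => _ [y yL <-].
apply: le_trans (_ : (dirderiv L x x / L x)%:E <= _)%E; last first.
  by apply: ereal_sup_ubound; exists x.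
rewrite lee_fin ler_wpM2r ?invr_ge0//.
(* The subgradient inequality at [x + h *: x] puts <x,y> below every quotient, hence below their
   infimum. *)
apply: (dirderiv_ray x cL L0 L_ge0).2 => h h0.
rewrite ler_pdivlMr//; have := yL (x + h *: x).
rewrite (addrC x) addrK.
have -> : dot y (h *: x) = dot x y * h.
  by rewrite /dot mulr_suml; apply: eq_bigr => i _; rewrite mxE; ring.
lra.
Qed.

(** * The function R_L and its right derivative at 1 *)

(** A point with |x| >= 1 keeps the supremum above [-oo], so [fine] loses nothing. *)
Lemma RLE (R : realType) (n : nat) (L : 'rV[R]_n -> R) (x : 'rV[R]_n) (r : R) :
  1 <= enorm x -> (dilation_ratio L r < +oo)%E -> (RL L r)%:E = dilation_ratio L r.
Proof.
move=> x1 fin; rewrite /RL fineK// fin_real// fin andbT.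
apply: lt_le_trans (_ : ((L (r *: x) / L x)%:E <= _)%E); first exact: ltNyr.
by apply: ereal_sup_ubound; exists x.
Qed.

(** The case of dimension 0: the supremum over the empty set is [-oo], which [fine] sends to 0. *)
Lemma RL_empty (R : realType) (n : nat) (L : 'rV[R]_n -> R) (r : R) :
  ~ (exists x : 'rV[R]_n, 1 <= enorm x) -> RL L r = 0.
Proof.
move=> noX; rewrite /RL /dilation_ratio (_ : [set _ | _ in _] = set0) ?ereal_sup0//.
by apply/seteqP; split=> // y [x x1 _]; case: noX; exists x.
Qed.

(** For each [z] the map r |-> L(r z) / L(z) is convex, and a supremum of convex functions is
    convex. *)
Lemma RL_convex (R : realType) (n : nat) (L : 'rV[R]_n -> R) (a b t : R) :
  jensen L -> (forall x, 0 <= L x) ->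
  (forall r, 0 <= r -> (dilation_ratio L r < +oo)%E) ->
  0 <= a -> 0 <= b -> 0 <= t -> t <= 1 ->
  RL L (t * a + (1 - t) * b) <= t * RL L a + (1 - t) * RL L b.
Proof.
move=> cL L_ge0 fin a0 b0 t0 t1.
have [[x x1]|noX] := pselect (exists x : 'rV[R]_n, 1 <= enorm x); last first.
  by rewrite !RL_empty// !mulr0 addr0.
have ab0 : 0 <= t * a + (1 - t) * b by rewrite addr_ge0// mulr_ge0// subr_ge0.
rewrite -lee_fin (RLE x1 (fin _ ab0)).
apply: ge_ereal_sup => _ [z z1 <-]; rewrite lee_fin.
have bound r : 0 <= r -> L (r *: z) / L z <= RL L r.
  move=> r0; rewrite -lee_fin (RLE x1 (fin _ r0)).
  by apply: ereal_sup_ubound; exists z.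
apply: le_trans (_ : t * (L (a *: z) / L z) + (1 - t) * (L (b *: z) / L z) <= _).
  rewrite !mulrA -mulrDl ler_wpM2r ?invr_ge0//.
  by rewrite scalerDl -!scalerA cL.
by rewrite lerD// ler_wpM2l ?bound// subr_ge0.
Qed.

(** If |x| >= 1 then R_L(1) = 1, so L'(x,x) / L(x) <= (L(x + h x) / L(x) - 1) / h <= (R_L(1 + h) -
    R_L(1)) / h, and the right derivative is the infimum of the last quotients. *)
Lemma RL_right_derivative (R : realType) (n : nat) (L : 'rV[R]_n -> R) :
  jensen L -> L 0 = 0 -> (forall x, 0 <= L x) -> (forall x, x != 0 -> 0 < L x) ->
  (forall r, 0 <= r -> (dilation_ratio L r < +oo)%E) ->
  right_derivable (RL L) 1 /\ (sup_dirderiv L <= (right_derivative (RL L) 1)%:E)%E.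
Proof.
move=> cL L0 L_ge0 L_gt0 fin.
have Lpos x : 1 <= enorm x -> 0 < L x by move=> x1; rewrite L_gt0// enorm_ge1_neq0.
have RL_ge x r : 1 <= enorm x -> 0 <= r -> L (r *: x) / L x <= RL L r.
  move=> x1 r0; rewrite -lee_fin (RLE x1 (fin _ r0)).
  by apply: ereal_sup_ubound; exists x.
have RL1 (x : 'rV[R]_n) : 1 <= enorm x -> RL L 1 = 1.
  move=> x1; apply/eqP; rewrite eq_le; apply/andP; split; last first.
    by have := RL_ge x 1 x1 ler01; rewrite scale1r divff ?gt_eqF ?Lpos.
  rewrite -lee_fin (RLE x1 (fin _ ler01)).
  by apply: ge_ereal_sup => _ [z z1 <-]; rewrite scale1r divff ?gt_eqF ?Lpos.
have [h t h0 t0 t1|h h0|l [lim_l _ le_l]] :=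
    @right_quotient_limit R (fun h => RL L (1 + h)) (RL L 1).
- have h1 : 0 <= 1 + h by lra.
  have := RL_convex cL L_ge0 fin h1 ler01 t0 t1.
  by rewrite (_ : t * (1 + h) + (1 - t) * 1 = 1 + t * h)//; ring.
- have [[x x1]|noX] := pselect (exists x : 'rV[R]_n, 1 <= enorm x); last first.
    by rewrite !RL_empty.
  have h1 : 0 <= 1 + h by lra.
  rewrite (RL1 x)//; apply: le_trans (RL_ge x _ x1 h1).
  rewrite ler_pdivlMr ?Lpos// mul1r -{1}[x]scale1r.
  by apply: jensen_ray_le => //; lra.
have -> : right_derivative (RL L) 1 = l by exact/cvg_lim.
split; first by apply/cvg_ex; exists l.
apply: ge_ereal_sup => _ [x x1 <-]; rewrite lee_fin.
apply: le_l => h h0; rewrite ler_pdivrMr ?Lpos// (RL1 x)//.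
apply: (le_trans ((dirderiv_ray x cL L0 L_ge0).1 h h0)).
rewrite mulrAC ler_wpM2r ?invr_ge0 ?(ltW h0)//.
have h1 : 0 <= 1 + h by lra.
have := RL_ge x _ x1 h1; rewrite ler_pdivrMr ?Lpos// scalerDl scale1r; lra.
Qed.

(** * The differentiable case and the conclusion *)

(** Linearity of the differential expands ['D_v L x] in the basis; its two-sided limit restricts to
    the right-hand limit of [dirderiv]. *)
Lemma gradient_dirderiv (R : realType) (n : nat) (L : 'rV[R]_n -> R) (x v : 'rV[R]_n) :
  differentiable L x -> dot (gradient L x) v = dirderiv L x v.
Proof.
move=> dL.
have -> : dot (gradient L x) v = 'D_v L x.
  rewrite deriveE// {2}[v]row_sum_delta linear_sum; apply: eq_bigr => i _.
  by rewrite linearZ/= mxE deriveE// mulrC.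
have /cvg_dnbhs_at_right := @diff_derivable _ _ _ L x v dL.
rewrite /dirderiv -/(derive L x v) => H.
apply/esym/cvg_lim => //; apply: cvg_trans H.
by apply: near_eq_cvg; near=> h; rewrite /= [h *: v + x]addrC mulrC.
Unshelve. all: by end_near. Qed.

Theorem proposition5p2 (R : realType) (n : nat) (L : 'rV[R]_n -> R)
    (L_ge0 : forall x, 0 <= L x)
    (L_convex : convex_function [set: convex_lmodType 'rV[R]_n] L)
    (L0 : L 0 = 0)
    (L_gt0 : forall x, x != 0 -> 0 < L x) :
  [/\ sup_dirderiv L = sup_subdifferential L,
      Delta2 L <-> (sup_dirderiv L < +oo)%E,
      Delta2 L ->
        [/\ forall r, 0 <= r -> (dilation_ratio L r < +oo)%E,
            right_derivable (RL L) 1,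
            (sup_dirderiv L <= (right_derivative (RL L) 1)%:E)%E &
            (sup_subdifferential L <= (right_derivative (RL L) 1)%:E)%E] &
      (forall x, differentiable L x) ->
        (Delta2 L <-> (sup_gradient L < +oo)%E)].
Proof.
have cL : jensen L by exact: convex_function_jensen.
have sup_eq := sup_dirderivE cL L0 L_ge0 L_gt0.
have fin : Delta2 L -> forall r, 0 <= r -> (dilation_ratio L r < +oo)%E.
  move=> D2 r r0; have [M HM] := Delta2_growth cL L0 L_ge0 L_gt0 D2 r0.
  apply: le_lt_trans (ltry M).
  by apply: ge_ereal_sup => _ [x x1 <-]; rewrite lee_fin HM.
have D2P : Delta2 L <-> (sup_dirderiv L < +oo)%E.
  split=> [D2|/ereal_sup_lty[p p0 Dp]].
    have [_ supD] := RL_right_derivative cL L0 L_ge0 L_gt0 (fin D2).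
    exact: le_lt_trans supD (ltry _).
  apply: (dirderiv_bound_Delta2 cL L0 L_ge0 p0) => x x1.
  by rewrite -ler_pdivrMr ?Dp// L_gt0// enorm_ge1_neq0.
split=> // [D2|dL].
  have [dRL supD] := RL_right_derivative cL L0 L_ge0 L_gt0 (fin D2).
  by split=> //; [exact: fin|rewrite -sup_eq].
(* The two suprema agree term by term, so the equivalence is the one already proved. *)
suff -> : sup_gradient L = sup_dirderiv L by [].
rewrite /sup_gradient /sup_dirderiv; congr ereal_sup.
by apply: eq_imagel => x _; rewrite gradient_dirderiv.
Qed.
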